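(* Let $n\equiv 1\pmod 6$, $n\ge 7$, and $m=(n-1)/3$. Label the blocks of the Skolem Steiner triple system of order $n$ from $0$ to $\frac{n(n-1)}{6}-1$ in the following order: $B_x$, $x=0,1,\ldots,m/2-1$, followed by $B_{x,y,i}$, $y=1,2,\ldots,m-1$, $x=0,1,\ldots,y-1$, $i=0,1,2$ ($y$ being the outermost and $i$ the innermost index), followed by the blocks $B_{x,i}$, $x=0,1,\ldots,m/2-1$, $i=0,1,2$, where the block $B_{x,i}$ is labeled $$\frac{n(n-1)}{6}-\frac{n-1}{2}+\begin{cases}(n-1)/6+2x,& i=0,\\ x,& i=1,\\ (n-1)/6+2x+1,& i=2.\end{cases}$$ Then the dual of this system has min-sum (i.e. the dual min-sum of the system with this labeling is) equal to $$f_{SYXI}(n)=\begin{cases}\dfrac{55}{1728}n^3-\dfrac{31}{576}n^2-\dfrac{137}{576}n-\dfrac{1279}{1728}, & \text{if } (n-1)/3\equiv 0\pmod 4,\ n\ge 13,\\[2mm] \dfrac{55}{1728}n^3-\dfrac{31}{576}n^2-\dfrac{173}{576}n+\dfrac{1421}{1728}, & \text{if } (n-1)/3\equiv 2\pmod 4,\ n\ge 7.\end{cases}$$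
   Context: For integers $a\le b$, $[a,b]=\{a,\ldots,b\}$. Skolem Steiner triple system of order $n=3m+1$, $m\ge2$ even: for $x,y\in[0,m-1]$ let $r\in[0,m-1]$ be the residue of $x+y$ modulo $m$, and set $x\oplus_s y=r/2$ if $r$ is even and $x\oplus_s y=(r+m-1)/2$ if $r$ is odd. The point set is $\{\infty\}\cup\{(x,i): x\in[0,m-1],\ i\in[0,2]\}$, and the blocks are $B_x=\{(x,0),(x,1),(x,2)\}$ for $x\in[0,m/2-1]$; $B_{x,y,i}=\{(x,i),(y,i),(x\oplus_s y,\ i+1\bmod 3)\}$ for $0\le x<y\le m-1$, $i\in[0,2]$; and $B_{x,i}=\{\infty,(x+m/2,i),(x,\ i+1\bmod 3)\}$ for $x\in[0,m/2-1]$, $i\in[0,2]$. There are $n(n-1)/6$ blocks. Given a bijective labeling of the blocks by $0,1,\ldots,n(n-1)/6-1$, the dual min-sum (min-sum of the dual) is the minimum, over all points $p$, of the sum of the labels of all blocks containing $p$. *)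

(* Defs.v *)
From mathcomp Require Import all_boot all_order all_algebra.

Set Implicit Arguments.
Unset Strict Implicit.
Unset Printing Implicit Defensive.

Section LabeledSystem.
Variables (T : finType) (D : {set {set T}}) (lab : {set T} -> nat).

(* lab maps the blocks of D bijectively onto {0, ..., N - 1}; in particular
   #|D| = N. *)
Definition block_labeling (N : nat) : Prop :=
  perm_eq [seq lab B | B in D] (iota 0 N).

Definition point_sum (p : T) : nat := \sum_(B in D | p \in B) lab B.

(* Minimum of the point sums over all points; p0 only witnesses that there is a
   point, and the value does not depend on it. *)
Definition dual_min_sum (p0 : T) : nat :=
  \big[minn/point_sum p0]_(p : T) point_sum p.

End LabeledSystem.

Section Skolem.
Variable m : nat.

(* None is the point at infinity. *)
Definition point := option ('I_m * 'I_3).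

Lemma residue_subproof (x : 'I_m) (k : nat) : k %% m < m.
Proof. by rewrite ltn_mod (leq_trans _ (ltn_ord x)). Qed.

(* The residue of k modulo m; x only witnesses that m is positive. *)
Definition residue (x : 'I_m) (k : nat) : 'I_m :=
  Ordinal (residue_subproof x k).

Lemma skolem_op_subproof (x y : 'I_m) :
  let r := (x + y) %% m in
  (if odd r then (r + m - 1)./2 else r./2) < m.
Proof.
have m_gt0 : 0 < m by rewrite (leq_trans _ (ltn_ord x)).
rewrite /=; set r := (x + y) %% m; have ltrm : r < m by rewrite ltn_mod.
case: ifP => _; last first.
  by apply: leq_ltn_trans _ ltrm; rewrite leq_half_double -addnn leqW // leq_addr.
rewrite ltn_half_double -addnn; apply: leq_ltn_trans (leq_subr 1 _) _.
by rewrite ltn_add2r.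
Qed.

Definition skolem_op (x y : 'I_m) : 'I_m := Ordinal (skolem_op_subproof x y).

Definition block_diag (x : 'I_m) : {set point} :=
  [set Some (x, i) | i : 'I_3].

(* ordS i is i + 1 modulo 3. *)
Definition block_mixed (x y : 'I_m) (i : 'I_3) : {set point} :=
  [set Some (x, i); Some (y, i); Some (skolem_op x y, ordS i)].

(* Only used for x < m / 2, where the residue of x + m / 2 is x + m / 2. *)
Definition block_inf (x : 'I_m) (i : 'I_3) : {set point} :=
  [set None; Some (residue x (x + m./2), i); Some (x, ordS i)].

Definition skolem_blocks : {set {set point}} :=
  [set block_diag x | x : 'I_m & x < m./2]
  :|: \bigcup_(i : 'I_3) \bigcup_(y : 'I_m)
        [set block_mixed x y i | x : 'I_m & x < y]
  :|: \bigcup_(i : 'I_3) [set block_inf x i | x : 'I_m & x < m./2].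

(* The blocks avoiding infinity, in the order of their labels; enum 'I_k is
   increasing. *)
Definition finite_block_seq : seq {set point} :=
  [seq block_diag x | x <- [seq x : 'I_m <- enum 'I_m | x < m./2]]
  ++ flatten [seq
       flatten [seq
         [seq block_mixed x y i | i <- enum 'I_3]
       | x <- [seq x : 'I_m <- enum 'I_m | x < y]]
     | y <- [seq y : 'I_m <- enum 'I_m | 0 < y]].

Definition syxi_inf_label (x : 'I_m) (i : 'I_3) : nat :=
  let n := 3 * m + 1 in
  n * (n - 1) %/ 6 - (n - 1) %/ 2 +
  match val i with
  | 0 => (n - 1) %/ 6 + 2 * x
  | 1 => x
  | _ => (n - 1) %/ 6 + 2 * x + 1
  end.

(* A block through infinity is block_inf x i for exactly one pair (x, i) with
   x < m / 2, which pick recovers; any other block is labeled by its position. *)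
Definition syxi_label (B : {set point}) : nat :=
  if [pick xi : 'I_m * 'I_3 | (xi.1 < m./2) && (B == block_inf xi.1 xi.2)]
    is Some (x, i) then syxi_inf_label x i
  else index B finite_block_seq.

End Skolem.

Local Open Scope ring_scope.

(* For n = 1 modulo 6, (n - 1) / 3 is even, so the second case is the one where
   it is 2 modulo 4. *)
Definition f_SYXI (n : nat) : rat :=
  let N : rat := n%:R in
  if ((n - 1) %/ 3 %% 4 == 0)%N then
    55 / 1728 * N ^+ 3 - 31 / 576 * N ^+ 2 - 137 / 576 * N - 1279 / 1728
  else
    55 / 1728 * N ^+ 3 - 31 / 576 * N ^+ 2 - 173 / 576 * N + 1421 / 1728.

(* Main.v *)
(* Write m = 2h, so that n = 6h + 1. The pairs x < y with x (+) y = z are the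
   pairs on two antidiagonals x + y = s and x + y = s + m, where s = 2z for
   z < h and s = 2(z - h) + 1 otherwise, so every point sum is a cubic
   polynomial. For z < h, the points (z, 0) and (z, 1) have equal sums, and
   (z, 2) has a larger or equal one. The cubic for (z, 0) is minimal over
   0 <= z < h at the integer part k of h / 2, since its increment from there is
   z - k times a quadratic of the same sign. All other points have larger or
   equal sums. The parity of h gives the two cases. *)
Require Import Defs.
From mathcomp Require Import all_boot all_order all_algebra.
From mathcomp Require Import zify ring lra.

Set Implicit Arguments.
Unset Strict Implicit.
Unset Printing Implicit Defensive.

Import Order.TTheory GRing.Theory Num.Theory.

(** * Positions in lists, minima and small sums *)

(** The labels along [s] read 0, 1, 2, ..., so the label of an entry is its position, which [index]
    recovers in the duplicate-free image. *)
Lemma index_map_iota (T U : eqType) (f : T -> U) (g : T -> nat) s c :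
  uniq (map f s) -> map g s = iota 0 (size s) -> c \in s ->
  index (f c) (map f s) = g c.
Proof.
move=> Us gs cs; have lt_c : index c s < size s by rewrite index_mem.
have := congr1 (fun t => nth 0 t (index c s)) gs.
rewrite (nth_map c) // nth_iota // nth_index // add0n => ->.
by rewrite -{1}(nth_index c cs) -(nth_map c (f c)) // index_uniq ?size_map.
Qed.

Lemma dual_min_sum_eq (T : finType) (D : {set {set T}}) (lab : {set T} -> nat)
    (p0 p : T) :
  (forall q, point_sum D lab p <= point_sum D lab q) ->
  dual_min_sum D lab p0 = point_sum D lab p.
Proof.
move=> min_p; apply/eqP; rewrite eqn_leq /dual_min_sum; apply/andP; split.
  have : p \in index_enum T by rewrite mem_index_enum.
  elim: (index_enum T) => //= q s IHs; rewrite big_cons in_cons geq_min.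
  by case/predU1P => [<-|/IHs ->]; rewrite ?leqnn ?orbT.
(* The default value of the big minimum is itself a point sum, so the lower bound covers it too. *)
by elim/big_ind: _ => // a b pa pb; rewrite leq_min pa.
Qed.

Lemma sum_pred1_nat (F : nat -> nat) a n :
  \sum_(0 <= x < n) (x == a) * F x = (a < n) * F a.
Proof.
elim: n => [|n IHn]; first by rewrite big_geq.
rewrite big_nat_recr //= {}IHn ltnS.
by case: (ltngtP a n) => [||->]; rewrite ?mul0n ?mul1n ?addn0.
Qed.

Lemma bin2Z n : (2 * 'C(n, 2)%:Z = n%:Z * (n%:Z - 1))%R.
Proof. by elim: n => // n IHn; rewrite binS bin1; lia. Qed.

Lemma ordS3_neq (i : 'I_3) : (ordS i == i) = false.
Proof. by case: i => [[|[|[|]]]]. Qed.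

Lemma ordSS3_neq (i : 'I_3) : (ordS (ordS i) == i) = false.
Proof. by case: i => [[|[|[|]]]]. Qed.

(** * Membership in blocks and injectivity of their parametrization *)

Section Skolem.
Variables (m h : nat).
Hypotheses (m_double : m = h.*2) (h_gt0 : 0 < h).

Let halfm : m./2 = h. Proof. by rewrite m_double doubleK. Qed.

(* Parameters of the blocks: distinct parameters can give the same block only
   outside valid_code. *)
Definition code := ('I_m + 'I_m * 'I_m * 'I_3 + 'I_m * 'I_3)%type.

Definition code_block (c : code) : {set point m} :=
  match c with
  | inl (inl x) => block_diag x
  | inl (inr (x, y, i)) => block_mixed x y i
  | inr (x, i) => block_inf x i
  end.

Definition valid_code (c : code) : bool :=
  match c with
  | inl (inl x) => x < h
  | inl (inr (x, y, _)) => x < y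
  | inr (x, _) => x < h
  end.

(** The [h] diagonal blocks come first, then three blocks for each of the ['C(y, 2)] pairs with
    larger entry below [y] and of the [x] earlier pairs of row [y]. *)
Definition mixed_label (x y i : nat) : nat := h + 3 * ('C(y, 2) + x) + i.

Definition code_label (c : code) : nat :=
  match c with
  | inl (inl x) => x
  | inl (inr (x, y, i)) => mixed_label x y i
  | inr (x, i) => syxi_inf_label x i
  end.

Lemma in_block_diag (x z : 'I_m) (j : 'I_3) :
  (Some (z, j) \in block_diag x) = (z == x).
Proof.
apply/imsetP/eqP => [[i _ [-> _]] //|->]; by exists j.
Qed.

Lemma None_block_diag (x : 'I_m) : None \notin block_diag x.
Proof. by apply/imsetP => -[]. Qed.

Lemma in_block_mixed (x y z : 'I_m) (i j : 'I_3) :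
  (Some (z, j) \in block_mixed x y i) =
  (j == i) && ((z == x) || (z == y)) || (j == ordS i) && (z == skolem_op x y).
Proof.
rewrite !inE !(inj_eq Some_inj) !xpair_eqE.
by rewrite andb_orr ![(j == _) && _]andbC.
Qed.

Lemma None_block_mixed (x y : 'I_m) (i : 'I_3) : None \notin block_mixed x y i.
Proof. by rewrite !inE. Qed.

Lemma in_block_inf (x z : 'I_m) (i j : 'I_3) : x < h ->
  (Some (z, j) \in block_inf x i) =
  (j == i) && (z == x + h :> nat) || (j == ordS i) && (z == x).
Proof.
move=> xh; rewrite !inE !(inj_eq Some_inj) !xpair_eqE -!val_eqE /= halfm.
rewrite modn_small; last by lia.
by rewrite ![(val j == _) && _]andbC.
Qed.

Lemma None_block_inf (x : 'I_m) (i : 'I_3) : None \in block_inf x i.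
Proof. by rewrite !inE. Qed.

(** The point [(x, ordS i)] has first coordinate below [h], while the other finite point of a block
    through infinity does not; so it reveals both parameters. *)
Lemma block_inf_inj (x x' : 'I_m) (i i' : 'I_3) : x < h -> x' < h ->
  block_inf x i = block_inf x' i' -> (x, i) = (x', i').
Proof.
move=> xh x'h /setP/(_ (Some (x, ordS i))).
rewrite !in_block_inf // !eqxx orbT.
have -> : (x == x' + h :> nat) = false by lia.
by rewrite andbF /= => /esym/andP[/eqP/ordS_inj-> /eqP->].
Qed.

(** If [i] and [i'] differed, comparing the levels of the two blocks would force i' = i + 1 and i =
    i' + 1 modulo 3, which is impossible. Level [i] then shows the pair, ordered by [x < y]. *)
Lemma block_mixed_inj (x x' y y' : 'I_m) (i i' : 'I_3) : x < y -> x' < y' ->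
  block_mixed x y i = block_mixed x' y' i' -> (x, y, i) = (x', y', i').
Proof.
move=> lxy lxy' /setP E.
have ii' : i = i'.
  have := E (Some (x, i)); have := E (Some (skolem_op x y, ordS i)).
  rewrite !in_block_mixed !eqxx orbT /= (inj_eq (@ordS_inj 3)).
  case: (eqVneq i i') => //= _; rewrite orbF => /esym/andP[/eqP <-] _.
  by rewrite eq_sym ordSS3_neq.
subst i'; have Ez z : (z == x) || (z == y) = (z == x') || (z == y').
  have := E (Some (z, i)); rewrite !in_block_mixed eqxx.
  by rewrite [i == ordS i]eq_sym ordS3_neq !orbF.
have := Ez x; have := Ez y; have := Ez x'; have := Ez y'.
rewrite !eqxx !orbT -!val_eqE /= => Hy' Hx' Hy Hx.
have -> : x = x' by apply: val_inj => /=; lia.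
by have -> : y = y' by apply: val_inj => /=; lia.
Qed.

(** Blocks of different kinds are separated by infinity and by level i' + 2, which a diagonal block
    meets and a mixed block of index i' misses. *)
Lemma code_block_inj : {in valid_code &, injective code_block}.
Proof.
have diag_mixed (x x' y' : 'I_m) (i' : 'I_3) : block_diag x <> block_mixed x' y' i'.
  move=> /setP/(_ (Some (x, ordS (ordS i')))).
  by rewrite in_block_diag in_block_mixed eqxx ordSS3_neq ordS3_neq.
have inf_diag (x x' : 'I_m) (i : 'I_3) : block_inf x i <> block_diag x'.
  by move=> E; have := None_block_inf x i; rewrite E (negPf (None_block_diag _)).
have inf_mixed (x x' y' : 'I_m) (i i' : 'I_3) : block_inf x i <> block_mixed x' y' i'.
  by move=> E; have := None_block_inf x i; rewrite E (negPf (None_block_mixed _ _ _)).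
move=> [[x|[[x y] i]]|[x i]] [[x'|[[x' y'] i']]|[x' i']];
  rewrite /in_mem /= => Vc Vc' E.
- congr (inl (inl _)); apply/eqP.
  by rewrite -(in_block_diag _ _ ord0) -E in_block_diag.
- by case: (diag_mixed _ _ _ _ E).
- by case: (inf_diag _ _ _ (esym E)).
- by case: (diag_mixed _ _ _ _ (esym E)).
- by rewrite (block_mixed_inj Vc Vc' E).
- by case: (inf_mixed _ _ _ _ _ (esym E)).
- by case: (inf_diag _ _ _ E).
- by case: (inf_mixed _ _ _ _ _ E).
- by rewrite (block_inf_inj Vc Vc' E).
Qed.

(** * Blocks in label order and bijectivity of the labeling *)

Definition ords_below (k : nat) : seq 'I_m := [seq x : 'I_m <- enum 'I_m | x < k].

Definition finite_codes : seq code :=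
  [seq inl (inl x) | x <- ords_below h]
  ++ flatten [seq
       flatten [seq
         [seq inl (inr (x, y, i)) | i <- enum 'I_3]
       | x <- ords_below y]
     | y : 'I_m <- [seq y : 'I_m <- enum 'I_m | 0 < y]].

Definition inf_codes : seq code := [seq inr (x, i) | x <- ords_below h, i <- enum 'I_3].

Lemma finite_block_seqE : finite_block_seq m = map code_block finite_codes.
Proof.
rewrite /finite_block_seq /finite_codes map_cat -map_comp halfm; congr (_ ++ _).
rewrite map_flatten -map_comp; congr flatten; apply: eq_map => y /=.
rewrite map_flatten -map_comp; congr flatten; apply: eq_map => x /=.
by rewrite -(map_comp code_block).
Qed.

Lemma val_ords_below k : k <= m -> map val (ords_below k) = iota 0 k.
Proof.
move=> km; rewrite -(filter_map val (fun x => x < k)) val_enum_ord.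
rewrite -{1}(subnKC km) iotaD filter_cat -[RHS]cats0; congr (_ ++ _).
  by apply/all_filterP/allP => x; rewrite mem_iota.
apply/eqP; rewrite -(negbK (_ == _)) -has_filter; apply/hasPn => x.
by rewrite mem_iota -leqNgt => /andP[].
Qed.

Lemma map_ords_below T (F : nat -> T) k : k <= m ->
  [seq F x | x : 'I_m <- ords_below k] = [seq F x | x <- iota 0 k].
Proof. by move=> km; rewrite -val_ords_below // -map_comp. Qed.

Lemma flatten_iota a b k :
  flatten [seq iota (a + b * x) b | x <- iota 0 k] = iota a (b * k).
Proof.
elim: k => [|k IHk]; first by rewrite muln0.
by rewrite -addn1 iotaD map_cat flatten_cat IHk mulnDr iotaD /= cats0 muln1 add0n.
Qed.

(** Row [y] covers the interval of length [3 * y] from [h + 3 * 'C(y, 2)], and consecutive rows abut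
    by Pascal's rule. *)
Lemma map_code_label_finite :
  map code_label finite_codes = iota 0 (h + 3 * 'C(m, 2)).
Proof.
rewrite iotaD map_cat -map_comp; congr (_ ++ _).
  by rewrite (map_ords_below id) ?map_id // m_double -addnn leq_addr.
rewrite map_flatten -map_comp add0n.
transitivity (flatten [seq iota (h + 3 * 'C(y, 2)) (3 * y) | y <- iota 0 m]).
  rewrite -val_enum_ord -map_comp.
  have labels_y (y : 'I_m) : map code_label (flatten
      [seq [seq inl (inr (x, y, i)) | i <- enum 'I_3] | x <- ords_below y]) =
      iota (h + 3 * 'C(y, 2)) (3 * y).
    rewrite map_flatten -(map_comp (map code_label)) -flatten_iota.
    rewrite -(map_ords_below (fun x => iota (h + 3 * 'C(y, 2) + 3 * x) 3)); last exact: ltnW.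
    congr flatten; apply: eq_map => x /=.
    transitivity [seq h + 3 * 'C(y, 2) + 3 * x + i | i <- map val (enum 'I_3)].
      by rewrite -!map_comp; apply: eq_map => i /=; rewrite /mixed_label; lia.
    by rewrite val_enum_ord -iotaDl addn0.
  elim: (enum 'I_m) => [//|y s IHs].
  rewrite -[RHS]/(iota (h + 3 * 'C(y, 2)) (3 * y) ++ flatten _) -{}IHs -labels_y /=.
  (* The enumeration starts at y = 1, which loses nothing since row 0 is empty. *)
  by case: posnP => [y0|_] //; rewrite /ords_below y0 filter_pred0.
elim: m => [|k IHk]; first by [].
rewrite -(addn1 k) iotaD map_cat flatten_cat IHk /= cats0 addn1 binS bin1.
by rewrite add0n (mulnDr 3 'C(k, 2)) iotaD.
Qed.

Lemma uniq_ords_below k : uniq (ords_below k).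
Proof. by rewrite filter_uniq // enum_uniq. Qed.

Lemma mem_ords_below k x : (x \in ords_below k) = (x < k).
Proof. by rewrite mem_filter mem_enum andbT. Qed.

Lemma mem_finite_codes c : (c \in finite_codes) = if c is inl _ then valid_code c else false.
Proof.
rewrite mem_cat; apply/orP/idP => [[/mapP[x]|/flatten_mapP[y _ /flatten_mapP[x]]]|].
- by rewrite mem_ords_below => ? ->.
- by rewrite mem_ords_below => ? /mapP[i _ ->].
case: c => [[x|[[x y] i]]|//] /= lt; [left|right].
  by apply: map_f; rewrite mem_ords_below.
apply/flatten_mapP; exists y; first by rewrite mem_filter mem_enum andbT (leq_ltn_trans _ lt).
apply/flatten_mapP; exists x; first by rewrite mem_ords_below.
by apply: map_f; rewrite mem_enum.
Qed.

Lemma mem_inf_codes c : (c \in inf_codes) = if c is inr _ then valid_code c else false.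
Proof.
apply/allpairsP/idP => [[[x i] /= []]|]; first by rewrite mem_ords_below => ? _ ->.
by case: c => // -[x i] /= xh; exists (x, i); split; rewrite ?mem_ords_below ?mem_enum.
Qed.

Definition codes := finite_codes ++ inf_codes.

Lemma mem_codes c : (c \in codes) = valid_code c.
Proof. by rewrite mem_cat mem_finite_codes mem_inf_codes; case: c => c; rewrite ?orbF. Qed.

Lemma uniq_codes : uniq codes.
Proof.
rewrite cat_uniq (map_uniq (f := code_label)) ?map_code_label_finite ?iota_uniq //=.
apply/andP; split.
  apply/hasPn => c; rewrite mem_inf_codes mem_finite_codes; by case: c.
by apply: allpairs_uniq; rewrite ?uniq_ords_below ?enum_uniq // => -[x i] [x' i'] _ _ [-> ->].
Qed.

Lemma uniq_blocks : uniq (map code_block codes).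
Proof.
rewrite map_inj_in_uniq ?uniq_codes // => c c'; rewrite !mem_codes; exact: code_block_inj.
Qed.

Lemma mem_blocks B : (B \in skolem_blocks m) = (B \in map code_block codes).
Proof.
apply/idP/mapP.
  rewrite !inE halfm => /orP[/orP[/imsetP[x xh ->]|]|].
  - by exists (inl (inl x)); rewrite ?mem_codes //; rewrite inE in xh.
  - move=> /bigcupP[i _ /bigcupP[y _ /imsetP[x xy ->]]].
    by exists (inl (inr (x, y, i))); rewrite ?mem_codes //; rewrite inE in xy.
  - move=> /bigcupP[i _ /imsetP[x xh ->]].
    by exists (inr (x, i)); rewrite ?mem_codes //; rewrite inE in xh.
case=> c; rewrite mem_codes => Vc ->; rewrite !inE halfm.
case: c Vc => [[x|[[x y] i]]|[x i]] /= lt.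
- by rewrite imset_f // inE.
- apply/orP; left; apply/orP; right; apply/bigcupP; exists i => //.
  by apply/bigcupP; exists y => //; apply: imset_f; rewrite inE.
- by apply/orP; right; apply/bigcupP; exists i => //; apply: imset_f; rewrite inE.
Qed.

Lemma perm_blocks : perm_eq (enum (skolem_blocks m)) (map code_block codes).
Proof.
apply: uniq_perm; rewrite ?enum_uniq ?uniq_blocks // => B.
by rewrite mem_enum mem_blocks.
Qed.

Lemma size_finite_codes : size finite_codes = h + 3 * 'C(m, 2).
Proof. by rewrite -(size_map code_label) map_code_label_finite size_iota. Qed.

(** By injectivity [pick] can only return the parameters of the block itself; a block avoiding
    infinity is found at the position given by its label. *)
Lemma syxi_label_code c : valid_code c -> syxi_label (code_block c) = code_label c.
Proof.
move=> Vc; rewrite /syxi_label; case: pickP => [[x i] /= /andP[]|no_inf].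
  rewrite halfm => xh /eqP E; have Vx : valid_code (inr (x, i)) by [].
  by rewrite (code_block_inj Vc Vx E).
rewrite finite_block_seqE (@index_map_iota _ _ _ code_label) //.
- by have := uniq_blocks; rewrite map_cat cat_uniq => /andP[].
- by rewrite map_code_label_finite size_finite_codes.
rewrite mem_finite_codes; case: c Vc no_inf => // -[x i] /= xh /(_ (x, i)) /=.
by rewrite halfm xh eqxx.
Qed.

Lemma map_syxi_label : map (@syxi_label m) (map code_block codes) = map code_label codes.
Proof.
rewrite -map_comp; apply/eq_in_map => c; rewrite mem_codes; exact: syxi_label_code.
Qed.

(** The least label of a block through infinity, n(n-1)/6 - (n-1)/2 at n = 6h + 1. *)
Definition inf_base := 6 * h * h - 2 * h.

Lemma syxi_inf_labelE (x : 'I_m) (i : 'I_3) :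
  syxi_inf_label x i = inf_base + nth 0 [:: h + 2 * x; val x; h + 2 * x + 1] i.
Proof.
rewrite /syxi_inf_label /inf_base.
have -> : 3 * m + 1 = 6 * h + 1 by lia.
have -> : (6 * h + 1) * (6 * h + 1 - 1) %/ 6 = (6 * h + 1) * h.
  by rewrite addnK mulnCA mulKn.
have -> : (6 * h + 1 - 1) %/ 2 = 3 * h by lia.
have -> : (6 * h + 1 - 1) %/ 6 = h by lia.
congr (_ + _); first by lia.
by case: i => -[|[|[|]]].
Qed.

(** Above [inf_base], level 1 uses the first [h] offsets and levels 0 and 2 alternate on the next
    2h. These 3h labels are distinct and lie in an interval of length 3h, so they fill it by
    counting. *)
Lemma codes_labeling : perm_eq (map code_label codes) (iota 0 (h * (6 * h + 1))).
Proof.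
have binE : 'C(m, 2) = h * (m - 1) by rewrite bin2 m_double -doubleMl doubleK subn1.
have -> : h * (6 * h + 1) = (h + 3 * 'C(m, 2)) + 3 * h by rewrite binE; nia.
rewrite iotaD map_cat map_code_label_finite perm_cat2l add0n.
have baseE : h + 3 * 'C(m, 2) = inf_base by rewrite binE /inf_base; nia.
rewrite baseE.
have injL : {in inf_codes &, injective code_label}.
  move=> c c'; rewrite !mem_inf_codes; case: c c' => // -[x i] [] // [x' i'] /= xh xh'.
  rewrite !syxi_inf_labelE => /addnI E.
  suff [/val_inj-> /val_inj->] : x = x' :> nat /\ i = i' :> nat by [].
  by case: i i' E => -[|[|[|//]]] ? [[|[|[|//]]] ?] /=; lia.
have Us : uniq (map code_label inf_codes).
  rewrite map_inj_in_uniq //; have := uniq_codes; rewrite cat_uniq; by case/and3P.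
have sub : {subset map code_label inf_codes <= iota inf_base (3 * h)}.
  move=> l /mapP[c]; rewrite mem_inf_codes; case: c => // -[x i] /= xh ->.
  rewrite mem_iota syxi_inf_labelE.
  by case: i => -[|[|[|//]]] ? /=; lia.
apply: uniq_perm => //; first exact: iota_uniq.
have [] // := uniq_min_size Us sub.
rewrite size_iota size_map size_allpairs size_enum_ord -(size_map val).
by rewrite val_ords_below ?size_iota; lia.
Qed.

Lemma skolem_block_labeling :
  block_labeling (skolem_blocks m) (@syxi_label m) (h * (6 * h + 1)).
Proof.
rewrite /block_labeling; apply: perm_trans codes_labeling.
by rewrite -map_syxi_label; apply/perm_map/perm_blocks.
Qed.

(** * Point sums split by kind of block *)

Lemma point_sum_codes p :
  point_sum (skolem_blocks m) (@syxi_label m) p =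
  \sum_(c <- codes) (p \in code_block c) * code_label c.
Proof.
rewrite /point_sum -big_enum_cond (perm_big _ perm_blocks) big_map /=.
rewrite big_seq_cond big_mkcond [RHS]big_seq [RHS]big_mkcond /=; apply: eq_bigr => c _.
rewrite mem_codes; case: (boolP (valid_code c)) => //= Vc.
by rewrite syxi_label_code //; case: (p \in _); rewrite ?mul1n.
Qed.

Lemma sum_ords_below (F : 'I_m -> nat) k :
  \sum_(x <- ords_below k) F x = \sum_(x < m | x < k) F x.
Proof. by rewrite big_filter big_enum_cond. Qed.

Lemma point_sum_split p :
  point_sum (skolem_blocks m) (@syxi_label m) p =
  \sum_(x < m | x < h) (p \in block_diag x) * x
  + \sum_(y < m) \sum_(x < m | x < y)
      \sum_(i < 3) (p \in block_mixed x y i) * mixed_label x y i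
  + \sum_(x < m | x < h) \sum_(i < 3) (p \in block_inf x i) * syxi_inf_label x i.
Proof.
rewrite point_sum_codes !big_cat !big_map /= sum_ords_below; congr (_ + _ + _).
  rewrite big_flatten big_map big_filter big_enum_cond big_mkcond /=.
  apply: eq_bigr => y _; rewrite big_flatten big_map sum_ords_below.
  case: posnP => [y0|_]; first by rewrite big_pred0 // => x; rewrite y0.
  by apply: eq_bigr => x _; rewrite big_map big_enum.
rewrite big_allpairs_dep sum_ords_below; apply: eq_bigr => x _; exact: big_enum.
Qed.

Lemma sum_ord_narrow (F : nat -> nat) k : k <= m ->
  \sum_(x < m | x < k) F x = \sum_(0 <= x < k) F x.
Proof. by move=> km; rewrite big_mkord (big_ord_widen m). Qed.

Lemma sum_diag (z : 'I_m) (j : 'I_3) :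
  \sum_(x < m | x < h) (Some (z, j) \in block_diag x) * x = (z < h) * z.
Proof.
under eq_bigr do rewrite in_block_diag eq_sym -val_eqE /=.
by rewrite (sum_ord_narrow (fun x => (x == z) * x)) ?sum_pred1_nat; lia.
Qed.

Definition inf_label (x i : nat) := inf_base + nth 0 [:: h + 2 * x; x; h + 2 * x + 1] i.

(** A point with z < h is the unshifted point of its only block through infinity, one level above
    the index of that block. *)
Lemma sum_inf_low (z : 'I_m) (i : 'I_3) : z < h ->
  \sum_(x < m | x < h) \sum_(k < 3)
    (Some (z, ordS i) \in block_inf x k) * syxi_inf_label x k = inf_label z i.
Proof.
move=> zh; rewrite (bigD1 z) //= (bigD1 i) //= !big1 ?addn0.
- by rewrite in_block_inf // !eqxx orbT mul1n syxi_inf_labelE.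
- move=> x /andP[xh xz]; rewrite big1 // => k _; rewrite in_block_inf //.
  rewrite (negPf (_ : z != x)) 1?eq_sym //.
  by rewrite (_ : (z == x + h :> nat) = false) ?andbF //; lia.
move=> k ki; rewrite in_block_inf // (inj_eq (@ordS_inj 3)) [i == k]eq_sym (negPf ki).
by rewrite (_ : (z == z + h :> nat) = false) ?andbF //; lia.
Qed.

Lemma sum_inf_high (z : 'I_m) (j : 'I_3) : h <= z ->
  \sum_(x < m | x < h) \sum_(k < 3)
    (Some (z, j) \in block_inf x k) * syxi_inf_label x k = inf_label (z - h) j.
Proof.
move=> zh; have ltz := ltn_ord z; have lt_w : z - h < m by lia.
rewrite (bigD1 (Ordinal lt_w)) /=; last by lia.
have in_inf (x : 'I_m) k : x < h ->
    Some (z, j) \in block_inf x k = (j == k) && (z == x + h :> nat).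
  move=> xh; rewrite in_block_inf // (_ : (z == x) = false) ?andbF ?orbF //.
  by rewrite -val_eqE /=; lia.
rewrite (bigD1 j) //= !big1 ?addn0.
- rewrite in_inf /=; last by lia.
  by rewrite subnK // !eqxx mul1n syxi_inf_labelE.
- move=> x /andP[xh xz]; rewrite big1 // => k _; rewrite in_inf //.
  rewrite -val_eqE /= in xz; rewrite (_ : (z == x + h :> nat) = false) ?andbF //; lia.
move=> k kj; rewrite in_inf /=; last by lia.
by rewrite eq_sym (negPf kj).
Qed.

Lemma sum_inf_None :
  \sum_(x < m | x < h) \sum_(k < 3) (None \in block_inf x k) * syxi_inf_label x k
  = \sum_(0 <= x < h) (3 * inf_base + (2 * h + 1) + 5 * x).
Proof.
rewrite -sum_ord_narrow; last by lia.
apply: eq_bigr => x _.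
under eq_bigr do rewrite None_block_inf mul1n syxi_inf_labelE.
rewrite !big_ord_recl big_ord0 /=; lia.
Qed.

(** Only two indices k contribute: [ordS i], where z is one of x and y, and [i], where z is their
    product. *)
Lemma sum_mixed (z : 'I_m) (i : 'I_3) :
  \sum_(y < m) \sum_(x < m | x < y) \sum_(k < 3)
     (Some (z, ordS i) \in block_mixed x y k) * mixed_label x y k
  = \sum_(0 <= y < m) \sum_(0 <= x < y)
      ((x == z) + (y == z)) * mixed_label x y (ordS i)
  + \sum_(y < m) \sum_(x < m | x < y) (skolem_op x y == z) * mixed_label x y i.
Proof.
rewrite big_mkord -big_split /=; apply: eq_bigr => y _.
rewrite -sum_ord_narrow 1?ltnW // -big_split /=; apply: eq_bigr => x xy.
rewrite (bigD1 (ordS i)) //= (bigD1 i) //=; last by rewrite eq_sym ordS3_neq.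
rewrite big1 ?addn0; last first.
  move=> k /andP[k1 k2]; rewrite in_block_mixed (inj_eq (@ordS_inj 3)).
  by rewrite ![_ == k]eq_sym (negPf k1) (negPf k2).
rewrite !in_block_mixed !eqxx (inj_eq (@ordS_inj 3)) ordS3_neq /=.
rewrite (eq_sym i) ordS3_neq orbF (eq_sym z (skolem_op x y)); congr (_ * _ + _).
(* As x < y, at most one of the two equalities holds, so the disjunction is a sum. *)
rewrite -!val_eqE /=; lia.
Qed.

Lemma sum_interval (F : nat -> nat) a b : b <= m ->
  \sum_(0 <= y < m) (a <= y < b) * F y = \sum_(a <= y < b) F y.
Proof.
move=> bm; rewrite (big_nat_widenl a 0) // (big_nat_widen _ _ _ _ _ bm) big_mkcond.
by apply: eq_bigr => y _; case: ifP; rewrite ?mul1n.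
Qed.

Lemma sum_mixed_row (z j : nat) : z < m ->
  \sum_(0 <= y < m) \sum_(0 <= x < y) ((x == z) + (y == z)) * mixed_label x y j
  = \sum_(0 <= x < z) mixed_label x z j + \sum_(z.+1 <= y < m) mixed_label z y j.
Proof.
move=> zm; rewrite -[X in _ = _ + X]sum_interval //.
have := sum_pred1_nat (fun y => \sum_(0 <= x < y) mixed_label x y j) z m.
rewrite zm mul1n => <-; rewrite -big_split /=.
rewrite big_nat_cond [RHS]big_nat_cond; apply: eq_bigr => y /andP[/andP[_ ym] _].
under eq_bigr do rewrite mulnDl.
rewrite big_split /= (sum_pred1_nat (fun x => mixed_label x y j)) big_distrr /=.
by rewrite addnC ym andbT.
Qed.

(** On x + y = c the larger entry y determines x = c - y; here x < y means y > c / 2, and x >= 0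
    means y <= c. *)
Lemma sum_antidiagonal (F : nat -> nat -> nat) c :
  \sum_(0 <= y < m) \sum_(0 <= x < y) (x + y == c) * F x y
  = \sum_(c./2.+1 <= y < minn c.+1 m) F (c - y) y.
Proof.
rewrite -[RHS]sum_interval ?geq_minr // big_nat_cond [RHS]big_nat_cond.
apply: eq_bigr => y /andP[/andP[_ ym] _].
case: (leqP y c) => yc; last first.
  rewrite big_nat_cond big1 => [|x _]; first by rewrite (_ : _ && _ = false) //; lia.
  by rewrite (_ : (x + y == c) = false) //; lia.
transitivity (\sum_(0 <= x < y) (x == c - y) * F x y).
  by apply: eq_bigr => x _; congr (_ * _); lia.
by rewrite sum_pred1_nat; congr (_ * _); lia.
Qed.

(* The residue of x + y modulo m that makes z the value of x (+) y. *)
Definition op_index (z : nat) := if z < h then 2 * z else (2 * (z - h)).+1.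

(** As x + y < 2m, the residue is x + y or x + y - m. At most one equation holds, so their sum is
    again a truth value. *)
Lemma skolem_op_eq (x y z : 'I_m) : x < y ->
  (skolem_op x y == z) = (x + y == op_index z) + (x + y == op_index z + m) :> nat.
Proof.
move=> xy; rewrite -val_eqE /= /op_index.
have [xym|xym] := ltnP (x + y) m.
  rewrite modn_small //; case: ifP => Ho; case: ifP => zh; lia.
have -> : (x + y) %% m = x + y - m.
  by rewrite -{1}(subnK xym) modnDr modn_small //; have := ltn_ord y; lia.
case: ifP => Ho; case: ifP => zh; have := ltn_ord y; have := ltn_ord z; lia.
Qed.

Lemma sum_mixed_op (z : 'I_m) (i : nat) (s := op_index z) :
  \sum_(y < m) \sum_(x < m | x < y) (skolem_op x y == z) * mixed_label x y i
  = \sum_(s./2.+1 <= y < s.+1) mixed_label (s - y) y i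
  + \sum_(s./2.+1 + h <= y < m) mixed_label (s + m - y) y i.
Proof.
transitivity (\sum_(0 <= y < m) \sum_(0 <= x < y)
    ((x + y == s) + (x + y == s + m)) * mixed_label x y i).
  rewrite big_mkord; apply: eq_bigr => y _; rewrite -sum_ord_narrow 1?ltnW //.
  by apply: eq_bigr => x xy; rewrite skolem_op_eq.
under eq_bigr => y _ do (under eq_bigr => x _ do rewrite mulnDl; rewrite big_split /=).
rewrite big_split /= !sum_antidiagonal.
have lt_s : s < m by rewrite /s /op_index; have := ltn_ord z; case: ifP; lia.
(* The first antidiagonal ends at x = 0, the second at y = m - 1. *)
rewrite (minn_idPl lt_s) (_ : minn (s + m).+1 m = m); last by lia.
by rewrite (_ : (s + m)./2 = s./2 + h) //; lia.
Qed.

(** * Closed forms of the sums, doubled to clear the binomial denominators *)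

Lemma sum_mixed_label_row (z j : nat) (Z : int := z) :
  (2 * (\sum_(0 <= x < z) mixed_label x z j)%:Z
   = Z * (2 * h%:Z + 2 * j%:Z) + 3 * (Z + 1) * Z * (Z - 1))%R.
Proof.
(* The upper bound is freed for the induction, since [z] also occurs in the summand. *)
have E k : (2 * (\sum_(0 <= x < k) mixed_label x z j)%:Z
    = k%:Z * (2 * h%:Z + 6 * 'C(z, 2)%:Z + 2 * j%:Z) + 3 * k%:Z * (k%:Z - 1))%R.
  elim: k => [|k IHk]; first by rewrite big_geq.
  rewrite big_nat_recr //= /mixed_label PoszD mulrDr IHk; lia.
by rewrite E; have := bin2Z z; rewrite /Z; lia.
Qed.

Lemma sum_mixed_label_col (z j b : nat) (Z : int := z) (B : int := b) : z < b ->
  (2 * (\sum_(z.+1 <= y < b) mixed_label z y j)%:Z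
   = (B - Z - 1) * (2 * h%:Z + 6 * Z + 2 * j%:Z)
     + B * (B - 1) * (B - 2) - (Z + 1) * Z * (Z - 1))%R.
Proof.
rewrite /B => /subnKC <-; elim: (b - z.+1) => [|t IHt].
  by rewrite addn0 big_geq // /Z; lia.
rewrite addnS big_nat_recr ?leq_addr //= PoszD mulrDr IHt /mixed_label.
by have := bin2Z (z.+1 + t); rewrite /Z; lia.
Qed.

(** The cubic y(y-1)(y-5) is the antidifference of 3y(y-1) - 6y, the part of the doubled label that
    varies with y. *)
Lemma sum_mixed_label_anti (c a b i : nat) (C : int := c) (A : int := a) (B : int := b) :
  a <= b -> b <= c.+1 ->
  (2 * (\sum_(a <= y < b) mixed_label (c - y) y i)%:Z
   = (B - A) * (2 * h%:Z + 2 * i%:Z + 6 * C)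
     + B * (B - 1) * (B - 5) - A * (A - 1) * (A - 5))%R.
Proof.
rewrite /B => /subnKC <-; elim: (b - a) => [|t IHt] bc.
  by rewrite addn0 big_geq // /A; lia.
rewrite addnS in bc *; have {}IHt := IHt (ltnW bc).
rewrite big_nat_recr ?leq_addr //= PoszD mulrDr IHt /mixed_label.
by have := bin2Z (a + t); rewrite /A /C; lia.
Qed.

Lemma inf_baseZ : (inf_base : int) = (6 * h%:Z * h%:Z - 2 * h%:Z)%R.
Proof. rewrite /inf_base; nia. Qed.

(* Twice the label sum of the points (z, 0) and (z, 1), for z < h. *)
Definition low_poly (z : int) : int := let k : int := h in
  (8 * z * z * z - 3 * z * z * k - 12 * z * z - 3 * z * k * k + 18 * z * k - 14 * z
   + 15 * k * k * k - 3 * k * k + 4 * k - 2)%R.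

(* A lower bound for twice the label sum of the points (w + h, i). *)
Definition high_poly (w : int) : int := let k : int := h in
  (8 * w * w * w + 3 * w * w * k + 3 * w * k * k + 6 * w * k - 12 * w
   + 17 * k * k * k + 3 * k * k + 2 * k - 8)%R.

(** The level enters only through the offsets of the mixed labels and the label at infinity. These
    balance on levels 0 and 1; level 2, that is i = 1, keeps an excess, nonnegative for z < h. *)
Lemma point_sum_low (z : 'I_m) (i : 'I_3) : z < h ->
  (2 * (point_sum (skolem_blocks m) (@syxi_label m) (Some (z, ordS i)))%:Z =
   low_poly z + (i == 1 :> nat)%:Z * (4 * h%:Z - 2 * z%:Z - 4))%R.
Proof.
move=> zh; have ltz := ltn_ord z.
rewrite point_sum_split sum_diag zh mul1n sum_mixed sum_mixed_row //.
rewrite sum_mixed_op sum_inf_low //.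
rewrite /op_index zh (_ : (2 * z)./2 = z); last by lia.
have R := sum_mixed_label_row z (ordS i).
have Cl := sum_mixed_label_col (ordS i) ltz.
have := @sum_mixed_label_anti (2 * z) z.+1 (2 * z).+1 i.
have := @sum_mixed_label_anti (2 * z + m) (z.+1 + h) m i.
move=> /(_ ltac:(lia) ltac:(lia)) A2 /(_ ltac:(lia) ltac:(lia)) A1.
have mZ : (m%:Z = 2 * h%:Z)%R by lia.
rewrite !PoszD !mulrDr {}R {}Cl {}A1 {}A2 /inf_label PoszD inf_baseZ /low_poly.
case: i => -[|[|[|//]]] ? /=; rewrite ?modnn ?(PoszD, PoszM, intS) mZ; ring.
Qed.

(** The three levels differ only by terms linear in [w] and [h], smallest on level 1. *)
Lemma point_sum_high (z : 'I_m) (i : 'I_3) (w : nat) : z = w + h :> nat ->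
  (high_poly w <=
   2 * (point_sum (skolem_blocks m) (@syxi_label m) (Some (z, ordS i)))%:Z)%R.
Proof.
move=> zE; have zh : (z < h) = false by lia.
have ltz := ltn_ord z.
rewrite point_sum_split sum_diag zh mul0n add0n sum_mixed sum_mixed_row // sum_mixed_op.
have hz : h <= z by lia.
rewrite (sum_inf_high _ hz) /op_index zh zE addnK (_ : (2 * w).+1./2 = w); last by lia.
rewrite zE in ltz.
have R := sum_mixed_label_row (w + h) (ordS i).
have Cl := sum_mixed_label_col (ordS i) ltz.
have := @sum_mixed_label_anti (2 * w).+1 w.+1 (2 * w).+2 i.
have := @sum_mixed_label_anti ((2 * w).+1 + m) (w.+1 + h) m i.
move=> /(_ ltac:(lia) ltac:(lia)) A2 /(_ ltac:(lia) ltac:(lia)) A1.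
have mZ : (m%:Z = 2 * h%:Z)%R by lia.
rewrite !PoszD !mulrDr {}R {}Cl {}A1 {}A2 /inf_label PoszD inf_baseZ /high_poly.
have w_ge0 : (0 <= w%:Z)%R by [].
have h_ge0 : (0 <= h%:Z)%R by [].
case: i => -[|[|[|//]]] ? /=; rewrite ?modnn ?(PoszD, PoszM, intS) mZ; lra.
Qed.

Lemma point_sum_infinity :
  (2 * (point_sum (skolem_blocks m) (@syxi_label m) None)%:Z =
   36 * h%:Z * h%:Z * h%:Z - 3 * h%:Z * h%:Z - 3 * h%:Z)%R.
Proof.
rewrite point_sum_split big1 => [|x _]; last by rewrite (negPf (None_block_diag _)).
rewrite big1 => [|y _]; last first.
  rewrite big1 // => x _; rewrite big1 // => k _.
  by rewrite (negPf (None_block_mixed _ _ _)).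
rewrite sum_inf_None !add0n.
have E k : (2 * (\sum_(0 <= x < k) (3 * inf_base + (2 * h + 1) + 5 * x))%:Z =
    2 * k%:Z * (3 * inf_base%:Z + 2 * h%:Z + 1) + 5 * k%:Z * (k%:Z - 1))%R.
  elim: k => [|k IHk]; first by rewrite big_geq.
  rewrite big_nat_recr //= PoszD mulrDr IHk; lia.
rewrite E inf_baseZ; ring.
Qed.

(** * Comparison of the cubics and the final formula *)

Lemma low_poly_ge (k z : nat) : z < h -> h./2 = k -> (low_poly k <= low_poly z)%R.
Proof.
move=> zh <-; have hE := odd_double_half h.
move: (h./2) hE zh h_gt0 => {}k; rewrite /low_poly.
(* In each case the difference of the two sides becomes e + 1 times a
   polynomial that is nonnegative at natural numbers. *)
have [z_ltk|k_ltz|<- //] := ltngtP z k; case: (odd h) => <- zh k_gt0.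
- have [e [t [-> ->]]] : exists e t, k = e.+1 + t /\ z = t by exists (k - z).-1, z; lia.
  nia.
- have [e [t [-> ->]]] : exists e t, k = e.+1 + t /\ z = t by exists (k - z).-1, z; lia.
  nia.
(* Here h = 2k + 1, so z <= 2k and the distance e + 1 from k to z is at most k, with slack t. *)
- have [e [t [-> ->]]] : exists e t, k = e.+1 + t /\ z = (e.+1 + t) + e.+1.
    by exists (z - k).-1, (k - (z - k)); lia.
  nia.
(* Here h = 2k, so the distance is at most k - 1. *)
have [e [t [-> ->]]] : exists e t, k = e.+2 + t /\ z = (e.+2 + t) + e.+1.
  by exists (z - k).-1, (k - (z - k)).-1; lia.
nia.
Qed.

(** To leading order [low_poly] at h / 2 is 55/4 h^3, against at least 17 h^3 here and 36 h^3 at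
    infinity. Splitting by parity makes both sides polynomials in k. *)
Lemma high_poly_ge (w k : nat) : h./2 = k -> (low_poly k <= high_poly w)%R.
Proof.
move=> <-; have hE := odd_double_half h.
move: (h./2) hE h_gt0 => {}k; rewrite /low_poly /high_poly.
case: (odd h) => <- k_gt0; last by case: k k_gt0 => // k _; case: w => [|w]; nia.
by case: w => [|w]; nia.
Qed.

Lemma infinity_poly_ge (k : nat) : h./2 = k ->
  (low_poly k <= 36 * h%:Z * h%:Z * h%:Z - 3 * h%:Z * h%:Z - 3 * h%:Z)%R.
Proof.
move=> <-; have hE := odd_double_half h.
move: (h./2) hE h_gt0 => {}k; rewrite /low_poly.
case: (odd h) => <- k_gt0; last by case: k k_gt0 => // k _; nia.
by nia.
Qed.

Lemma skolem_dual_min_sum :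
  (2 * (dual_min_sum (skolem_blocks m) (@syxi_label m) None)%:Z = low_poly h./2)%R.
Proof.
have lt_kh : h./2 < h by lia.
have lt_km : h./2 < m by lia.
(* The successor of [ord_max] is level 0, so the minimizer is the point (h / 2, 0), without the
   excess of level 2. *)
pose z : 'I_m := Ordinal lt_km; pose i : 'I_3 := ord_max.
have Emin := @point_sum_low z i lt_kh.
rewrite mul0r addr0 in Emin.
rewrite -Emin; congr (2 * Posz _)%R; apply: dual_min_sum_eq => q.
suff : (low_poly h./2 <= 2 * (point_sum (skolem_blocks m) (@syxi_label m) q)%:Z)%R.
  by rewrite -Emin; lia.
case: q => [[x j]|]; last by rewrite point_sum_infinity infinity_poly_ge.
(* Each level is a successor modulo 3, the form in which the point sums were computed. *)
rewrite -(ord_predK j); case: (ltnP x h) => xh.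
  rewrite point_sum_low //; have := low_poly_ge xh erefl.
  by case: eqP => _; lia.
apply: le_trans (point_sum_high _ (_ : x = (x - h) + h :> nat)); last by lia.
exact: high_poly_ge.
Qed.

End Skolem.

Theorem theorem5 (n : nat) (hmod : n = 1 %[mod 6]) (hn : 7 <= n) :
  let m := (n - 1) %/ 3 in
  block_labeling (skolem_blocks m) (@syxi_label m) (n * (n - 1) %/ 6) /\
  ((dual_min_sum (skolem_blocks m) (@syxi_label m) None)%:R = f_SYXI n :> rat)%R.
Proof.
move=> m; pose h := n %/ 6.
have nE : n = 6 * h + 1 by rewrite /h; lia.
have h_gt0 : 0 < h by lia.
have mE : m = h.*2 by rewrite /m; lia.
split.
  have -> : n * (n - 1) %/ 6 = h * (6 * h + 1).
    by rewrite nE addnK mulnCA mulKn // mulnC.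
  exact: skolem_block_labeling.
have := skolem_dual_min_sum mE h_gt0.
move: (dual_min_sum _ _ _) => v vE.
have -> : (v%:R = (2 * v%:Z)%:~R / 2 :> rat)%R by rewrite rmorphM /=; field.
(* Since (n - 1) / 3 = 2h, divisibility by 4 is evenness of h. *)
have parity : ((n - 1) %/ 3 %% 4 == 0) = ~~ odd h by lia.
rewrite /f_SYXI parity vE /low_poly nE; have := odd_double_half h; move: (h./2) => k.
by rewrite -muln2; case: (odd h) => <- /=; field.
Qed.
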